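(* Let $A(n)$ be a $2\times 3$ matrix and $m(n)$ a $2$-dimensional vector, all of whose entries are integer-valued polynomials in $n$, and suppose that $$t(m(n)\mid A(n))=\#\{x\in\mathbb{Z}_{\geq 0}^3 : A(n)x=m(n)\}$$ is finite for each $n\in\mathbb{N}$. If $A(n)$ is 1-prime, then $t(m(n)\mid A(n))$ is a quasi-polynomial in $n$ for $n$ sufficiently large; that is, there exist an integer-valued quasi-polynomial $f$ and an integer $N_0$ such that $t(m(n)\mid A(n))=f(n)$ for all integers $n\geq N_0$.
   Context: $\mathbb{N}$ denotes the nonnegative integers. An integer-valued polynomial in $n$ is a polynomial with rational coefficients taking integer values at all integers. A function $f:\mathbb{N}\to\mathbb{Z}$ is an integer-valued quasi-polynomial if there are a positive integer $T$ and polynomials $f_0,\dots,f_{T-1}\in\mathbb{Z}[x]$ such that $f(Tm+i)=f_i(m)$ for all $m\in\mathbb{N}$ and $0\leq i\leq T-1$. These functions form a ring $R$ under pointwise operations. A $k\times(k+1)$ matrix $A(n)$ with integer-valued polynomial entries is 1-prime if the generalized greatest common divisor in $R$ of the elements $|\det(Y)|$, where $Y$ runs over all $k\times k$ submatrices of $A(n)$, equals $1$; this means that for every $n\in\mathbb{N}$ the integers $\det(Y)(n)$, with $Y$ running over all $k\times k$ submatrices, have greatest common divisor $1$. *)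

(* Defs.v *)
From mathcomp Require Import all_boot all_order all_algebra finmap.
From mathcomp Require Import boolp classical_sets functions cardinality.

Set Implicit Arguments.
Unset Strict Implicit.
Unset Printing Implicit Defensive.

Import Order.TTheory GRing.Theory Num.Theory.

Local Open Scope classical_set_scope.
Local Open Scope ring_scope.

Definition integer_valued (p : {poly rat}) : Prop :=
  forall z : int, p.[z%:~R] \is a Num.int.

(* The value p(n) as an integer; the floor only transports p.[n%:R] from rat
   to int and changes nothing when p is integer-valued. *)
Definition eval_int (n : nat) (p : {poly rat}) : int := Num.floor p.[n%:R].

Definition quasi_polynomial (f : nat -> int) : Prop :=
  exists (T : nat) (F : 'I_T -> {poly int}),
    (0 < T)%N /\ forall (m : nat) (i : 'I_T), f (T * m + i)%N = (F i).[m%:Z].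

(* The k x k submatrices of a k x (k+1) matrix are obtained by deleting one
   column; the determinants are polynomials in n, and their generalized gcd
   being 1 is a condition at every n. *)
Definition one_prime (k : nat) (A : 'M[{poly rat}]_(k, k.+1)) : Prop :=
  forall n : nat,
    \big[gcdn/0%N]_(j < k.+1) `|eval_int n (\det (col' j A))|%N = 1%N.

Definition solutions (k l : nat) (A : 'M[{poly rat}]_(k, l))
    (m : 'cV[{poly rat}]_k) (n : nat) : set 'cV[nat]_l :=
  [set x | map_mx (eval_int n) A *m map_mx Posz x = map_mx (eval_int n) m].

(* fset_set is empty on infinite sets, so this is the number of solutions only
   when the set of solutions is finite. *)
Definition t (k l : nat) (m : 'cV[{poly rat}]_k) (A : 'M[{poly rat}]_(k, l))
    (n : nat) : nat :=
  #|` fset_set (solutions A m n)|%fset.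

(* Main.v *)
(* On a residue class of n all entries become polynomials with integer
   coefficients. If the maximal minors d_j of A had a nonconstant common factor
   over the rationals it would, up to a bounded denominator, divide 1 for all n;
   hence sum_j u_j d_j is a nonzero constant N for some integer polynomials u_j.
   Since the d_j(n) are coprime and periodic modulo N, this can be corrected on
   each class modulo N to sum_j b_j d_j = 1. Up to signs b is then a row that
   completes A to a matrix of determinant 1, so that the integer solutions of
   A x = m form a line {p + k v : k in Z} with p and v polynomial in n. The
   nonnegative ones are cut out by the inequalities p_i + k v_i >= 0, that is, by
   k lying between floors of quotients of polynomials, which are eventually
   quasi-polynomial; finiteness guarantees that both bounds are present. *)
Require Import Defs.
From mathcomp Require Import all_boot all_order all_algebra finmap.
From mathcomp Require Import boolp classical_sets functions cardinality.
From mathcomp Require Import zify ring.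

Set Implicit Arguments.
Unset Strict Implicit.
Unset Printing Implicit Defensive.

Import Order.TTheory GRing.Theory Num.Theory.

Local Open Scope ring_scope.

(** * Eventual behaviour of integer polynomials *)

Definition eventually (P : nat -> Prop) : Prop :=
  exists N : nat, forall n, (N <= n)%N -> P n.

Lemma eventually_mono (P Q : nat -> Prop) :
  (forall n, P n -> Q n) -> eventually P -> eventually Q.
Proof. by move=> PQ [N PN]; exists N => n /PN/PQ. Qed.

Lemma eventually_and (P Q : nat -> Prop) :
  eventually P -> eventually Q -> eventually (fun n => P n /\ Q n).
Proof.
move=> [N PN] [M QM]; exists (maxn N M) => n.
by rewrite geq_max => /andP[/PN ? /QM].
Qed.

Lemma eventually_all (I : finType) (P : I -> nat -> Prop) :
  (forall i, eventually (P i)) -> eventually (fun n => forall i, P i n).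
Proof.
move=> /fin_all_exists[N PN]; exists (\max_i N i) => n Nn i.
by apply: PN; apply: leq_trans Nn; apply: leq_bigmax.
Qed.

Lemma eventually_unbounded (u : nat -> nat) (P : nat -> Prop) :
  (forall n, (n <= u n)%N) -> eventually P -> eventually (fun n => P (u n)).
Proof. by move=> u_ge [N PN]; exists N => n Nn; apply/PN/(leq_trans Nn). Qed.

(** Induction along Horner's scheme: once [p] is at least 1 at [n], the product [p.[n] * n] is at
    least [n], which eventually exceeds the absolute value of the constant term [c]. *)
Lemma eventually_pos (p : {poly int}) :
  0 < lead_coef p -> eventually (fun n => 0 < p.[n%:Z]).
Proof.
elim/poly_ind: p => [|p c IHp]; first by rewrite lead_coef0.
have [-> | p_neq0] := eqVneq p 0.
  by rewrite mul0r add0r lead_coefC => c_gt0; exists 0%N => n _; rewrite hornerC.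
rewrite lead_coefDl; last first.
  by rewrite size_mulX // size_polyC ltnS; case: (c != 0); rewrite ?lt0n ?size_poly_eq0.
rewrite lead_coefMX => /IHp[N pN]; exists (maxn N `|c|.+1) => n.
rewrite geq_max !hornerE => /andP[/pN p_gt0 c_lt_n].
have : n%:Z <= p.[n%:Z] * n%:Z by rewrite ler_peMl // -gtz0_ge1.
by move: (p.[_] * _) => y; lia.
Qed.

Lemma eventually_sign (p : {poly int}) :
  [\/ p = 0, eventually (fun n => 0 < p.[n%:Z])
    | eventually (fun n => p.[n%:Z] < 0)].
Proof.
have [p_lt0 | p_gt0 | /eqP] := ltgtP (lead_coef p) 0.
- apply: Or33; have := @eventually_pos (- p); rewrite lead_coefN oppr_gt0.
  by move=> /(_ p_lt0); apply: eventually_mono => n; rewrite hornerN oppr_gt0.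
- by apply: Or32; apply: eventually_pos.
- by rewrite lead_coef_eq0 => /eqP; apply: Or31.
Qed.

Definition progression (T i : nat) : {poly int} := T%:Z *: 'X + i%:Z%:P.

Lemma horner_progression (T i m : nat) :
  (progression T i).[m%:Z] = (T * m + i)%N%:Z.
Proof. by rewrite !hornerE; lia. Qed.

(** The polynomial [p - p.[i]] is a multiple of ['X - i], and the progression turns ['X - i] into
    [T *: 'X]. This is the form in which periodicity modulo [T] is used throughout. *)
Lemma comp_progression (p : {poly int}) (T i : nat) :
  exists e : {poly int},
    p \Po progression T i = p.[i%:Z]%:P + T%:Z *: e.
Proof.
have /factor_theorem[q pE] : root (p - p.[i%:Z]%:P) i%:Z.
  by rewrite /root !hornerE subrr.
exists ((q \Po progression T i) * 'X).
rewrite -[p in LHS](subrK p.[i%:Z]%:P) pE comp_polyD comp_polyC comp_polyM.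
rewrite comp_polyB comp_polyX comp_polyC /progression.
by rewrite addrK addrC scalerAr.
Qed.

(** * Eventual quasi-polynomials *)

(** Each residue class has its own threshold, which makes closure properties easy; a common
    threshold is taken only when passing to [quasi_polynomial]. *)
Definition eventual_qp (f : nat -> int) : Prop :=
  exists2 T, (0 < T)%N & forall i, (i < T)%N ->
    exists p : {poly int}, eventually (fun m => f (T * m + i)%N = p.[m%:Z]).

Lemma eventual_qp_quasi_polynomial (f : nat -> int) : eventual_qp f ->
  exists g, quasi_polynomial g /\ eventually (fun n => f n = g n).
Proof.
move=> [T T_gt0 fT].
have /fin_all_exists[p fp] := fun i : 'I_T => fT i (ltn_ord i).
exists (fun n => (p (Ordinal (ltn_pmod n T_gt0))).[(n %/ T)%N%:Z]); split.
  exists T, p; split=> // m i; rewrite mulnC divnMDl // divn_small // addn0.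
  by congr (horner (p _) _); apply: val_inj; rewrite /= modnMDl modn_small.
have [N fN] := eventually_all fp; exists (T * N)%N => n Nn.
rewrite {1}(divn_eq n T) mulnC.
by apply: (fN (n %/ T)%N _ (Ordinal (ltn_pmod n T_gt0))); rewrite leq_divRL // mulnC.
Qed.

Lemma eventual_qp_eq (f g : nat -> int) :
  eventually (fun n => f n = g n) -> eventual_qp g -> eventual_qp f.
Proof.
move=> fg [T T_gt0 gT]; exists T => // i /gT[p gp]; exists p.
have class_ge m : (m <= T * m + i)%N by nia.
have fg_class := eventually_unbounded class_ge fg.
by apply: eventually_mono (eventually_and gp fg_class) => m [<- ->].
Qed.

Lemma eventual_qp_poly (p : {poly int}) : eventual_qp (fun n => p.[n%:Z]).
Proof.
exists 1%N => // i; rewrite ltnS leqn0 => /eqP->; exists p, 0%N => m _.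
by rewrite mul1n addn0.
Qed.

Lemma eventual_qp_cst (c : int) : eventual_qp (fun=> c).
Proof.
by apply: eventual_qp_eq (eventual_qp_poly c%:P); exists 0%N => n _; rewrite hornerC.
Qed.

(** Passing to multiples of the period brings several functions to a common period. With
    [S = s * T], one has [S * m + i = T * (s * m + i %/ T) + i %% T]. *)
Lemma eventual_qp_refine (f : nat -> int) : eventual_qp f ->
  exists2 T, (0 < T)%N & forall S i, (T %| S)%N ->
    exists p : {poly int}, eventually (fun m => f (S * m + i)%N = p.[m%:Z]).
Proof.
move=> [T T_gt0 fT]; exists T => // _ i /dvdnP[s ->].
have [p fp] := fT _ (ltn_pmod i T_gt0); case: (posnP s) => [-> | s_gt0].
  by exists (f i)%:P, 0%N => m _; rewrite hornerC.
exists (p \Po progression s (i %/ T)).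
have class_ge m : (m <= s * m + i %/ T)%N by apply/leq_trans/leq_addr; apply: leq_pmull.
apply: eventually_mono (eventually_unbounded class_ge fp) => m.
by rewrite horner_comp horner_progression => <-; congr f; rewrite {1}(divn_eq i T); ring.
Qed.

(** The pieces may have different periods; their product [U] serves them all, so [T * U] is a period
    for [f]. *)
Lemma eventual_qp_merge (f : nat -> int) (T : nat) : (0 < T)%N ->
  (forall i, (i < T)%N -> eventual_qp (fun m => f (T * m + i)%N)) ->
  eventual_qp f.
Proof.
move=> T_gt0 fT.
have /fin_all_exists[S fS] : forall i : 'I_T, exists S, (0 < S)%N /\
    forall U j, (S %| U)%N -> exists p : {poly int},
      eventually (fun m => f (T * (U * m + j) + i)%N = p.[m%:Z]).
  by move=> i; have [S] := eventual_qp_refine (fT i (ltn_ord i)); exists S.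
pose U := (\prod_i S i)%N.
have U_gt0 : (0 < U)%N by apply: prodn_gt0 => i; have [] := fS i.
exists (T * U)%N => [|r rTU]; first by rewrite muln_gt0 T_gt0.
have [_ /(_ U (r %/ T)%N)[|p fp]] := fS (Ordinal (ltn_pmod r T_gt0)).
  by rewrite /U (bigD1 (Ordinal (ltn_pmod r T_gt0))) //= dvdn_mulr.
exists p; apply: eventually_mono fp => m /= <-; congr f.
by rewrite {1}(divn_eq r T); ring.
Qed.

Lemma eventual_qp_op2 (op : int -> int -> int) :
  (forall p q : {poly int}, eventual_qp (fun n => op p.[n%:Z] q.[n%:Z])) ->
  forall f g, eventual_qp f -> eventual_qp g ->
    eventual_qp (fun n => op (f n) (g n)).
Proof.
move=> op_poly f g /eventual_qp_refine[T T_gt0 fT] /eventual_qp_refine[S S_gt0 gS].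
apply: (@eventual_qp_merge _ (T * S)%N) => [|i _]; first by rewrite muln_gt0 T_gt0.
have [|p fp] := fT (T * S)%N i; first exact: dvdn_mulr.
have [|q gq] := gS (T * S)%N i; first exact: dvdn_mull.
apply: eventual_qp_eq (op_poly p q).
by apply: eventually_mono (eventually_and fp gq) => n [-> ->].
Qed.

Lemma eventual_qp_opp (f : nat -> int) :
  eventual_qp f -> eventual_qp (fun n => - f n).
Proof.
move=> fP; apply: (@eventual_qp_op2 (fun x _ => - x) _ f f fP fP) => p _.
by apply: eventual_qp_eq (eventual_qp_poly (- p)); exists 0%N => n _; rewrite hornerN.
Qed.

Lemma eventual_qp_add (f g : nat -> int) :
  eventual_qp f -> eventual_qp g -> eventual_qp (fun n => f n + g n).
Proof.
apply: (@eventual_qp_op2 (fun x y => x + y)) => p q.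
by apply: eventual_qp_eq (eventual_qp_poly (p + q)); exists 0%N => n _; rewrite hornerD.
Qed.

(** Of two polynomials one eventually dominates, according to the eventual sign of their
    difference. *)
Lemma eventual_qp_max (f g : nat -> int) :
  eventual_qp f -> eventual_qp g -> eventual_qp (fun n => Num.max (f n) (g n)).
Proof.
apply: (@eventual_qp_op2 Num.max) => p q.
have [/eqP | pq | pq] := eventually_sign (p - q).
- rewrite subr_eq0 => /eqP->; apply: eventual_qp_eq (eventual_qp_poly q).
  by exists 0%N => n _; rewrite maxxx.
- apply: eventual_qp_eq (eventual_qp_poly p); apply: eventually_mono pq => n.
  by rewrite hornerD hornerN subr_gt0 => /ltW/max_idPl.
- apply: eventual_qp_eq (eventual_qp_poly q); apply: eventually_mono pq => n.
  by rewrite hornerD hornerN subr_lt0 => /ltW/max_idPr.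
Qed.

(* Pseudo-division gives [c p = q v + r] with [c > 0] and [deg r < deg v]. On
   each class modulo [c] the values of [q] are [c Q + rho] with a constant
   [0 <= rho < c], so that [c (p - Q v) = rho v + r] lies in [(-v, c v)] and the
   quotient of [p] by [v] is [Q] or [Q - 1], depending on the eventual sign of
   [rho v + r]. *)
Lemma eventual_qp_divz (p v : {poly int}) : 0 < lead_coef v ->
  eventual_qp (fun n => (p.[n%:Z] %/ v.[n%:Z])%Z).
Proof.
move=> v_gt0; have v_neq0 : v != 0 by rewrite -lead_coef_eq0 gt_eqF.
have := Pdiv.Idomain.divp_eq p v; have := Pdiv.Idomain.ltn_modp p v.
rewrite v_neq0; move: (p %/ v)%R (p %% v)%R => q r r_lt_v.
have : 0 < lead_coef v ^+ scalp p v by rewrite exprn_gt0.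
move: (lead_coef v ^+ _) => [c|//] c_gt0 pE.
apply: (@eventual_qp_merge _ c) => // j _.
have [e qE] := comp_progression q c j.
have [s [rho [qj rho_ge0 rho_lt_c]]] :
    exists s rho : int, [/\ q.[j%:Z] = c%:Z * s + rho, 0 <= rho & rho < c%:Z].
  exists (q.[j%:Z] %/ c)%Z, (q.[j%:Z] %% c)%Z; split; last exact: ltz_pmod.
    by rewrite mulrC -divz_eq.
  by apply: modz_ge0; lia.
pose Q := s%:P + e; pose comp (u : {poly int}) := u \Po progression c j.
pose w := rho *: comp v + comp r.
have compE u n : (comp u).[n%:Z] = u.[(c * n + j)%N%:Z].
  by rewrite /comp horner_comp horner_progression.
have wE n : w.[n%:Z] = c%:Z * (p.[(c * n + j)%N%:Z] - Q.[n%:Z] * v.[(c * n + j)%N%:Z]).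
  have := congr1 (fun u => u.[(c * n + j)%N%:Z]) pE.
  rewrite hornerD hornerM hornerZ mulrBr => ->.
  have <- := compE q n; rewrite {1}/comp qE qj /w !hornerD !hornerZ !hornerC !compE.
  ring.
have class_ge n : (n <= c * n + j)%N by nia.
have [v_pos r_lt r_gt] : [/\ eventually (fun n => 0 < v.[n%:Z]),
    eventually (fun n => r.[n%:Z] < v.[n%:Z])
  & eventually (fun n => - v.[n%:Z] < r.[n%:Z])].
  split; first exact: eventually_pos.
  - apply: eventually_mono (@eventually_pos (v - r) _) => [n|].
      by rewrite !hornerE subr_gt0.
    by rewrite lead_coefDl // size_polyN.
  - apply: eventually_mono (@eventually_pos (v + r) _) => [n|].
      by rewrite !hornerE -[- _ < _]subr_gt0 opprK addrC.
    by rewrite lead_coefDl.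
have bounds : eventually (fun m => let n := (c * m + j)%N in
    [/\ 0 < v.[n%:Z], r.[n%:Z] < v.[n%:Z] & - v.[n%:Z] < r.[n%:Z]]).
  apply: eventually_mono (eventually_unbounded class_ge
    (eventually_and v_pos (eventually_and r_lt r_gt))).
  by move=> n [? []].
have quotient (D : {poly int}) :
    eventually (fun m => let n := (c * m + j)%N in
      0 <= p.[n%:Z] - D.[m%:Z] * v.[n%:Z] < v.[n%:Z]) ->
  eventual_qp (fun m => (p.[(c * m + j)%N%:Z] %/ v.[(c * m + j)%N%:Z])%Z).
  move=> D_bounds; apply: eventual_qp_eq (eventual_qp_poly D).
  apply: eventually_mono (eventually_and bounds D_bounds) => m /= [[v_m _ _]].
  move=> D_m; rewrite -[p.[_]](subrK (D.[m%:Z] * v.[(c * m + j)%N%:Z])).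
  by rewrite addrC divzMDl ?gt_eqF // divz_small ?addr0 // gtz0_abs.
have wE' n : w.[n%:Z] = rho * v.[(c * n + j)%N%:Z] + r.[(c * n + j)%N%:Z].
  by rewrite hornerD hornerZ !compE.
have w_lt : eventually (fun n => w.[n%:Z] < c%:Z * v.[(c * n + j)%N%:Z]).
  apply: eventually_mono bounds => n /= [v_n r_n _]; rewrite wE'.
  have : (rho + 1) * v.[(c * n + j)%N%:Z] <= c%:Z * v.[(c * n + j)%N%:Z].
    by apply: ler_wpM2r; [apply: ltW | lia].
  by rewrite mulrDl mul1r; apply: lt_le_trans; rewrite ltrD2l.
have w_gt : eventually (fun n => - (c%:Z * v.[(c * n + j)%N%:Z]) <= w.[n%:Z]).
  apply: eventually_mono bounds => n /= [v_n _ r_n]; rewrite wE'.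
  have : 0 <= rho * v.[(c * n + j)%N%:Z] by apply: mulr_ge0 => //; apply: ltW.
  have : v.[(c * n + j)%N%:Z] <= c%:Z * v.[(c * n + j)%N%:Z].
    by apply: ler_peMl; [apply: ltW | lia].
  move: (c%:Z * _) (rho * _) => x y; lia.
have [w0 | w_pos | w_neg] := eventually_sign w.
- apply: (quotient Q); apply: eventually_mono bounds => m /= [v_m _ _].
  have /esym/eqP := wE m; rewrite w0 horner0 mulf_eq0 gt_eqF //=.
  by move=> /eqP->; rewrite lexx.
- apply: (quotient Q); apply: eventually_mono (eventually_and w_lt w_pos).
  by move=> m /=; rewrite wE ltr_pM2l // pmulr_rgt0 // => -[-> /ltW->].
- apply: (quotient (Q - 1)).
  apply: eventually_mono (eventually_and w_gt w_neg) => m /=.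
  rewrite wE -mulrN ler_pM2l // pmulr_rlt0 // !hornerD hornerN !hornerC mulrBl mul1r.
  move: (_ * v.[_]) => x; lia.
Qed.

(** * Counting integers in quasi-polynomial intervals *)

(** The first alternative stands for the bound minus infinity, which no integer-valued [f] can
    express. *)
Definition lower_bounded_qp (S : nat -> int -> Prop) : Prop :=
  eventually (fun n => forall k, S n k) \/
  exists2 f, eventual_qp f & eventually (fun n => forall k, S n k <-> f n <= k).

Lemma lower_bounded_qp_and (S S' : nat -> int -> Prop) :
  lower_bounded_qp S -> lower_bounded_qp S' ->
  lower_bounded_qp (fun n k => S n k /\ S' n k).
Proof.
move=> [ST | [f fP Sf]] [S'T | [g gP S'g]].
- by left; apply: eventually_mono (eventually_and ST S'T) => n [].
- right; exists g => //; apply: eventually_mono (eventually_and ST S'g).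
  by move=> n [Sn S'n] k; rewrite -S'n; split=> [[]|].
- right; exists f => //; apply: eventually_mono (eventually_and Sf S'T).
  by move=> n [Sn S'n] k; rewrite -Sn; split=> [[]|].
- right; exists (fun n => Num.max (f n) (g n)); first exact: eventual_qp_max.
  apply: eventually_mono (eventually_and Sf S'g) => n [Sn S'n] k.
  by rewrite ge_max Sn S'n; split=> /andP.
Qed.

(* Upper bounds on [k] are lower bounds on [- k]. *)
Definition eventual_qp_interval (S : nat -> int -> Prop) : Prop :=
  exists L U, [/\ lower_bounded_qp L, lower_bounded_qp U &
    eventually (fun n => forall k, S n k <-> L n k /\ U n (- k))].

Lemma eventual_qp_interval_T : eventual_qp_interval (fun _ _ => True).
Proof.
by exists (fun _ _ => True), (fun _ _ => True); split; [left | left |]; exists 0%N.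
Qed.

Lemma eventual_qp_interval_and (S S' : nat -> int -> Prop) :
  eventual_qp_interval S -> eventual_qp_interval S' ->
  eventual_qp_interval (fun n k => S n k /\ S' n k).
Proof.
move=> [L [U [LP UP SLU]]] [L' [U' [L'P U'P S'LU]]].
exists (fun n k => L n k /\ L' n k), (fun n k => U n k /\ U' n k).
split; [exact: lower_bounded_qp_and | exact: lower_bounded_qp_and |].
apply: eventually_mono (eventually_and SLU S'LU) => n [Sn S'n] k.
by rewrite Sn S'n; tauto.
Qed.

Lemma eventual_qp_interval_forall (l : nat) (S : 'I_l -> nat -> int -> Prop) :
  (forall i, eventual_qp_interval (S i)) ->
  eventual_qp_interval (fun n k => forall i, S i n k).
Proof.
elim: l S => [|l IHl] S SP.
  have [L [U [LP UP TLU]]] := eventual_qp_interval_T; exists L, U; split=> //.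
  by apply: eventually_mono TLU => n TLU k; rewrite -TLU; split=> // _ [].
have [L [U [LP UP SLU]]] :=
  eventual_qp_interval_and (SP ord0) (IHl _ (fun i => SP (lift ord0 i))).
exists L, U; split=> //; apply: eventually_mono SLU => n SLU k.
rewrite -SLU; split=> [Sk | [S0 SS] i]; first by split.
by have [j|] := unliftP ord0 i => ->.
Qed.

(** The sign of the leading coefficient of [v] decides whether the inequality bounds [k] from below
    or from above. If [v = 0] it does not involve [k], and eventually holds for all [k] or for
    none. *)
Lemma eventual_qp_interval_halfline (p v : {poly int}) :
  eventual_qp_interval (fun n k => 0 <= p.[n%:Z] + v.[n%:Z] * k).
Proof.
have lowerT : lower_bounded_qp (fun _ _ => True) by left; exists 0%N.
have div_le (u w : {poly int}) : 0 < lead_coef w ->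
    lower_bounded_qp (fun n k => 0 <= u.[n%:Z] + w.[n%:Z] * k).
  (* For positive [w] the inequality says that [- k] is at most the floor of [u / w]. *)
  move=> w_gt0; right; exists (fun n => - (u.[n%:Z] %/ w.[n%:Z])%Z).
    exact/eventual_qp_opp/eventual_qp_divz.
  apply: eventually_mono (eventually_pos w_gt0) => n w_n k.
  by rewrite lerNl lez_divRL // mulNr -subr_ge0 opprK mulrC.
have [v_lt0 | v_gt0 | /eqP] := ltgtP (lead_coef v) 0.
- exists (fun _ _ => True), (fun n k => 0 <= p.[n%:Z] + (- v).[n%:Z] * k).
  split=> //; first by apply: div_le; rewrite lead_coefN oppr_gt0.
  by exists 0%N => n _ k; rewrite hornerN mulrNN; split=> // -[].
- exists (fun n k => 0 <= p.[n%:Z] + v.[n%:Z] * k), (fun _ _ => True).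
  by split=> //; [apply: div_le | exists 0%N => n _ k; split=> // -[]].
rewrite lead_coef_eq0 => /eqP->.
have [-> | p_pos | p_neg] := eventually_sign p.
- have [L [U [LP UP TLU]]] := eventual_qp_interval_T; exists L, U; split=> //.
  by apply: eventually_mono TLU => n TLU k; rewrite -TLU !horner0 mul0r addr0.
- have [L [U [LP UP TLU]]] := eventual_qp_interval_T; exists L, U; split=> //.
  apply: eventually_mono (eventually_and TLU p_pos) => n [{}TLU p_n] k.
  by rewrite -TLU horner0 mul0r addr0 ltW.
(* The empty set is presented by the contradictory bounds [1 <= k] and [0 <= - k]. *)
- exists (fun _ k => 1 <= k), (fun _ k => 0 <= k); split.
  + by right; exists (fun=> 1); [exact: eventual_qp_cst | exists 0%N].
  + by right; exists (fun=> 0); [exact: eventual_qp_cst | exists 0%N].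
  apply: eventually_mono p_neg => n p_n k; rewrite horner0 mul0r addr0 leNgt p_n.
  by split=> // -[]; lia.
Qed.

Lemma infinite_injection (T : Type) (S : set T) (h : nat -> T) :
  injective h -> (forall i, S (h i)) -> ~ finite_set S.
Proof.
move=> h_inj Sh /(@finite_preimage _ _ S h).
have -> : (h @^-1` S)%classic = setT by apply/seteqP; split=> // i _; exact: Sh.
by move=> /(_ (fun _ _ _ _ => @h_inj _ _))/infinite_nat.
Qed.

Lemma card_int_interval (S : set int) (a b : int) :
  (forall k, S k <-> a <= k <= b) ->
  #|` fset_set S|%fset%:Z = Num.max 0 (b - a + 1).
Proof.
move=> SE; pose N := absz (Num.max 0 (b - a + 1)).
have -> : Num.max 0 (b - a + 1) = N%:Z by rewrite gez0_abs // le_max lexx.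
congr Posz; apply: card_fset_set.
have -> : S = ((fun i : nat => a + i%:Z) @` `I_N)%classic.
  apply/seteqP; split=> k; [rewrite SE => /andP[ak kb] | case=> i /=].
    by exists (absz (k - a)); rewrite /= /N; lia.
  by rewrite SE /N => ? <-; lia.
by apply: inj_card_eq => i j _ _ /addrI [].
Qed.

(** A missing bound would put a whole ray of integers into [S n] for large [n], against finiteness.
    So both bounds exist, and the length of the interval is built from them by sums and a
    maximum. *)
Lemma eventual_qp_card_interval (S : nat -> int -> Prop) :
  (forall n, finite_set (S n)) -> eventual_qp_interval S ->
  eventual_qp (fun n => #|` fset_set (S n)|%fset%:Z).
Proof.
move=> S_fin [L [U [LP UP SLU]]].
(* The number [e] is the direction of the ray: [1] if no upper bound is present, [- 1] if no lower
   one is. *)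
have not_ub (f : nat -> int) (e : int) :
    e != 0 -> ~ eventually (fun n => forall i : nat, S n (e * (f n + i%:Z))).
  move=> e_neq0 [N /(_ N (leqnn N)) SN]; apply: (infinite_injection _ SN (S_fin N)).
  by move=> i j /(mulfI e_neq0)/addrI [].
move: LP UP => [LT | [f fP Lf]] [UT | [g gP Ug]].
- case: (not_ub (fun=> 0) 1) => //.
  apply: eventually_mono (eventually_and SLU (eventually_and LT UT)).
  by move=> n [Sn [Ln Un]] i; rewrite Sn.
- case: (not_ub g (- 1)) => //.
  apply: eventually_mono (eventually_and SLU (eventually_and LT Ug)).
  by move=> n [Sn [Ln Un]] i; rewrite Sn Un mulN1r opprK lerDl; split.
- case: (not_ub f 1) => //.
  apply: eventually_mono (eventually_and SLU (eventually_and Lf UT)).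
  by move=> n [Sn [Ln Un]] i; rewrite Sn Ln mul1r lerDl; split.
apply: (@eventual_qp_eq _ (fun n => Num.max 0 (- g n - f n + 1))); last first.
  apply: eventual_qp_max; first exact: eventual_qp_cst.
  apply: eventual_qp_add (eventual_qp_cst 1).
  by apply: eventual_qp_add; exact: eventual_qp_opp.
apply: eventually_mono (eventually_and SLU (eventually_and Lf Ug)).
move=> n [Sn [Ln Un]]; apply: card_int_interval => k.
by rewrite Sn Ln Un lerNr; split=> /andP.
Qed.

(** * Bezout identities for polynomials with coprime values *)

Lemma Bezout_bigz (l : nat) (z : 'I_l -> int) :
  exists a : 'I_l -> int,
    \sum_i a i * z i = (\big[gcdn/0%N]_i absz (z i))%:Z.
Proof.
elim: l z => [|l IHl] z; first by exists (fun=> 0); rewrite !big_ord0.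
have [a aE] := IHl (fun i => z (lift ord0 i)).
rewrite big_ord_recl; set g := \big[_/_]_(i < l) _.
have [u [v uvE]] := Bezoutz (z ord0) g%:Z.
exists (fun i => if unlift ord0 i is Some j then v * a j else u).
rewrite big_ord_recl unlift_none -[RHS]uvE -aE mulr_sumr; congr (_ + _).
by apply: eq_bigr => i _; rewrite liftK mulrA.
Qed.

(** A combination that divides every [d i] is a gcd of them, so no normalization has to be
    chosen. *)
Lemma Bezout_bigp (F : fieldType) (l : nat) (d : 'I_l -> {poly F}) :
  exists u : 'I_l -> {poly F}, forall i, \sum_i u i * d i %| d i.
Proof.
elim: l d => [|l IHl] d; first by exists (fun=> 0); case.
have [u uE] := IHl (fun i => d (lift ord0 i)).
set g := \sum_i _ in uE; have [[a b] /= abE] := Bezoutp (d ord0) g.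
exists (fun i => if unlift ord0 i is Some j then b * u j else a) => i.
have -> : \sum_j (if unlift ord0 j is Some j' then b * u j' else a) * d j =
    a * d ord0 + b * g.
  rewrite big_ord_recl unlift_none mulr_sumr; congr (_ + _).
  by apply: eq_bigr => j _; rewrite liftK mulrA.
rewrite (eqp_dvdl _ abE); have [j|] := unliftP ord0 i => ->.
  exact: dvdp_trans (dvdp_gcdr _ _) (uE j).
exact: dvdp_gcdl.
Qed.

Lemma common_denominator (I : finType) (q : I -> {poly rat}) :
  exists2 c, (0 < c)%N &
    exists Q : I -> {poly int}, forall i, map_poly intr (Q i) = c%:R *: q i.
Proof.
have /fin_all_exists[a] : forall i, exists a, (0 < a)%N /\
    exists Q : {poly int}, map_poly intr Q = a%:R *: q i.
  move=> i; have [Q [a a_neq0 ->]] := rat_poly_scale (q i).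
  exists (absz a); split; first by rewrite absz_gt0.
  (* The denominator [a] may be negative; its sign is moved into the numerator. *)
  exists (sgz a *: Q); rewrite map_polyZ scalerA; congr (_ *: _).
  have a_unit : a%:~R != 0 :> rat by rewrite intr_eq0.
  by apply: (mulIf a_unit); rewrite divfK //= -intrM -abszEsg.
move=> aP; exists (\prod_i a i)%N; first by apply: prodn_gt0 => i; have [] := aP i.
suff /fin_all_exists : forall i, exists Q : {poly int},
    map_poly intr Q = (\prod_i a i)%N%:R *: q i by [].
move=> i; have [_ [Q QE]] := aP i.
exists ((\prod_(j | j != i) a j)%N%:Z *: Q).
by rewrite map_polyZ QE scalerA [X in _ = X%:R *: _](bigD1 i) //= mulnC natrM -pmulrn.
Qed.

(** Divisors of [c] are bounded, whereas a nonconstant [g] is not. Comparing squares avoids absolute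
    values and makes the leading coefficient positive. *)
Lemma poly_dvd_cst (g : {poly int}) (c : int) : c != 0 ->
  (forall n : nat, (g.[n%:Z] %| c)%Z) -> exists2 a, a != 0 & g = a%:P.
Proof.
move=> c_neq0 g_dvd; have [/size1_polyC gE | g_size] := leqP (size g) 1.
  exists g`_0 => //; apply: contraNneq c_neq0 => g0.
  by have := g_dvd 0%N; rewrite gE g0 horner0 dvd0z.
have g_neq0 : g != 0 by rewrite -size_poly_gt0 ltnW.
have size_gg : (1 < size (g * g)%R)%N 
  by rewrite size_mul //; move: (size g) g_size => s; lia.
have [|N gN] := @eventually_pos (g * g - (c * c)%:P).
  rewrite lead_coefDl; last first.
    by rewrite size_polyN (leq_ltn_trans (size_polyC_leq1 _)).
  by rewrite lead_coefM -expr2 exprn_even_gt0 //= lead_coef_eq0.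
have := gN N (leqnn N); have /dvdzP[y cE] := g_dvd N.
rewrite !hornerE cE; have : y != 0.
  by apply: contraNneq c_neq0; rewrite cE => ->; rewrite mul0r.
move: g.[_] => x y_neq0.
have y2_ge1 : 1 <= y * y by nia.
rewrite subr_gt0 ltNge mulrACA ler_peMl //.
by rewrite -expr2 sqr_ge0.
Qed.

(* If the [d i] had a nonconstant common factor over [rat], then, up to a fixed
   denominator, it would divide [1] at every [n]. *)
Lemma constant_combination (l : nat) (d : 'I_l -> {poly int}) :
  (forall n : nat, \big[gcdn/0%N]_i absz (d i).[n%:Z] = 1%N) ->
  exists2 N, (0 < N)%N &
    exists u : 'I_l -> {poly int}, \sum_i u i * d i = N%:Z%:P.
Proof.
move=> d_gcd; pose toQ : {poly int} -> {poly rat} := map_poly intr.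
have toQ_inj : injective toQ by apply: map_inj_poly => //; exact: intr_inj.
have [u u_dvd] := Bezout_bigp (fun i => toQ (d i)).
set g := \sum_i _ in u_dvd.
(* Denominators are cleared separately: [c] for the quotients by the gcd [g], [a] for [g] itself,
   [e] for the Bezout coefficients. *)
have [c c_gt0 [H HE]] := common_denominator (fun i => toQ (d i) %/ g).
have [a a_gt0 [G GE]] := common_denominator (fun _ : unit => g).
have [e e_gt0 [U UE]] := common_denominator u.
have dE i : (a * c)%N%:Z *: d i = H i * G tt.
  apply: toQ_inj; rewrite /toQ [RHS]rmorphM /= HE GE map_polyZ /= -scalerAl -scalerAr.
  by rewrite divpK // scalerA -pmulrn mulnC natrM.
have [||y y_neq0 Gy] := @poly_dvd_cst (G tt) (a * c)%N%:Z.
- by rewrite -lt0n muln_gt0 a_gt0.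
(* A Bezout identity for the values at [n] writes [a * c] as a combination of the numbers [a * c *
   (d i).[n]], all multiples of [(G tt).[n]]. *)
- move=> n; have [b bE] := Bezout_bigz (fun i => (d i).[n%:Z]).
  have {}bE : \sum_i b i * (d i).[n%:Z] = 1 by rewrite bE d_gcd.
  rewrite -[X in (_ %| X)%Z]mulr1 -bE mulr_sumr.
  apply: rpred_sum => i _; rewrite mulrCA; apply: dvdz_mull.
  by rewrite -hornerZ dE hornerM dvdz_mull.
(* Over the rationals the left side is [a * e] times [g], that is, [e] times [G tt], and [G tt] is
   the constant [y]. *)
have sumE : \sum_i (a%:Z *: U i) * d i = (e%:Z * y)%:P.
  apply: toQ_inj; rewrite /toQ map_polyC /= rmorphM /= polyCM.
  rewrite rmorph_sum /=.
  transitivity ((a * e)%N%:R *: g).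
    rewrite /g scaler_sumr; apply: eq_bigr => i _.
    by rewrite rmorphM /= map_polyZ UE -!scalerAl scalerA natrM.
  by rewrite mulnC natrM -scalerA -(GE tt) Gy map_polyC /= -mul_polyC -pmulrn.
exists (e * absz y)%N; first by rewrite muln_gt0 e_gt0 absz_gt0.
exists (fun i => sgz y *: (a%:Z *: U i)).
transitivity (sgz y *: (e%:Z * y)%:P).
  by rewrite -sumE scaler_sumr; apply: eq_bigr => i _; rewrite -!scalerAl.
by rewrite -mul_polyC -polyCM mulrCA -abszEsg PoszM.
Qed.

Lemma Bezout_progression (l : nat) (d : 'I_l -> {poly int}) :
  (forall n : nat, \big[gcdn/0%N]_i absz (d i).[n%:Z] = 1%N) ->
  exists2 N, (0 < N)%N & forall j, exists b : 'I_l -> {poly int},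
    \sum_i b i * (d i \Po progression N j) = 1.
Proof.
move=> d_gcd; have [N N_gt0 [u uE]] := constant_combination d_gcd.
exists N => // j; have [a aE] := Bezout_bigz (fun i => (d i).[j%:Z]).
have {}aE : \sum_i a i * (d i).[j%:Z] = 1 by rewrite aE d_gcd.
have /fin_all_exists[e eE] := fun i => comp_progression (d i) N j.
pose w := \sum_i (a i)%:P * e i.
(* On the class of [j] the integers [a i] give the combination [1 + N w]. Subtracting [w] times the
   identity with value [N] leaves 1. *)
exists (fun i => (a i)%:P - w * (u i \Po progression N j)).
under eq_bigr do rewrite mulrBl -mulrA.
rewrite sumrB -mulr_sumr.
have -> : \sum_i (u i \Po progression N j) * (d i \Po progression N j) = N%:Z%:P.
  rewrite -(comp_polyC N%:Z (progression N j)) -uE rmorph_sum /=.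
  by apply: eq_bigr => i _; rewrite comp_polyM.
under eq_bigr do rewrite eE mulrDr -polyCM -scalerAr.
rewrite big_split /= -scaler_sumr -/w -rmorph_sum /= aE.
by rewrite mulrC mul_polyC addrK.
Qed.

(** * Completing the matrix to determinant one *)

Section AddRow.
Variables (R : comPzRingType) (k : nat).
Implicit Types (A : 'M[R]_(k, k.+1)) (b : 'I_k.+1 -> R) (m : 'cV[R]_k).

(** The signs cancel those of the cofactors along the last row, so that the determinant is the
    unsigned sum of the [b j] times the minors. *)
Definition add_row A b : 'M[R]_k.+1 :=
  \matrix_(i, j) if unlift ord_max i is Some i' then A i' j
                 else (-1) ^+ (k + j) * b j.

Definition add_entry m (a : R) : 'cV[R]_k.+1 :=
  \col_i if unlift ord_max i is Some i' then m i' ord0 else a.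

Lemma det_add_row A b : \det (add_row A b) = \sum_j b j * \det (col' j A).
Proof.
rewrite (expand_det_row _ ord_max); apply: eq_bigr => j _.
rewrite /cofactor mxE unlift_none /= mulrAC -!mulrA signrMK mulrC.
congr (_ * \det _); apply/matrixP=> i i'; rewrite !mxE.
by rewrite liftK.
Qed.

(** The right-hand side [a] of the added equation is unconstrained by [A x = m] and will parametrize
    the line of solutions. *)
Lemma add_row_mul A b m (x : 'cV[R]_k.+1) (a : R) :
  add_row A b *m x = add_entry m a <->
  A *m x = m /\ (add_row A b *m x) ord_max ord0 = a.
Proof.
have row_lift i : (add_row A b *m x) (lift ord_max i) ord0 = (A *m x) i ord0.
  by rewrite !mxE; apply: eq_bigr => j _; rewrite mxE liftK.
split=> [Mx | [Ax xa]].
  split; last by rewrite Mx mxE unlift_none.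
  by apply/matrixP=> i j; rewrite ord1 -row_lift Mx mxE liftK.
apply/matrixP=> i j; rewrite ord1 [RHS]mxE.
by case: unliftP => [i'|] ->; rewrite ?row_lift ?Ax.
Qed.

Lemma mul_add_entry (N : 'M[R]_k.+1) m (a : R) i :
  (N *m add_entry m a) i ord0 =
  (\sum_j N i (lift ord_max j) * m j ord0) + N i ord_max * a.
Proof.
rewrite mxE (bigD1_ord ord_max) //= mxE unlift_none addrC; congr (_ + _).
by apply: eq_bigr => j _; rewrite mxE liftK.
Qed.

End AddRow.

(** * Parametrizing and counting the nonnegative solutions *)

Definition nat_solutions (k l : nat) (A : 'M[int]_(k, l)) (m : 'cV[int]_k) :
    set 'cV[nat]_l :=
  [set x | A *m map_mx Posz x = m].

Lemma map_Posz_absz (l : nat) (x : 'cV[int]_l) :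
  (forall i, 0 <= x i ord0) -> map_mx Posz (map_mx absz x) = x.
Proof. by move=> x_ge0; apply/matrixP=> i j; rewrite ord1 !mxE gez0_abs. Qed.

(** The completed matrix has determinant 1, so its adjugate is its inverse. Each integer solution
    thus comes from exactly one [c], the last entry of its image under the completed matrix. *)
Lemma card_nat_solutions (k : nat) (A : 'M[int]_(k, k.+1)) (m : 'cV[int]_k)
    (b : 'I_k.+1 -> int) : \sum_j b j * \det (col' j A) = 1 ->
  (nat_solutions A m #=
   [set c | forall i, 0 <= (\adj (add_row A b) *m add_entry m c) i ord0])%card.
Proof.
move=> b_det; set M := add_row A b.
have MK (x : 'cV_k.+1) : M *m (\adj M *m x) = x.
  by rewrite mulmxA mul_mx_adj det_add_row b_det mul1mx.
have adjK (x : 'cV_k.+1) : \adj M *m (M *m x) = x.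
  by rewrite mulmxA mul_adj_mx det_add_row b_det mul1mx.
pose sol c := map_mx absz (\adj M *m add_entry m c).
have -> : nat_solutions A m = (sol @` [set c | forall i,
    0 <= (\adj M *m add_entry m c) i ord0])%classic.
  apply/seteqP; split=> [x Ax | _ [c /= c_ge0 <-]].
    have Mx : M *m map_mx Posz x = add_entry m ((M *m map_mx Posz x) ord_max ord0).
      exact/add_row_mul.
    exists ((M *m map_mx Posz x) ord_max ord0); rewrite /sol /= -Mx adjK.
      by move=> i; rewrite mxE.
    by apply/matrixP=> i j; rewrite !mxE.
  rewrite /nat_solutions /= map_Posz_absz //.
  by have /add_row_mul[] := MK (add_entry m c).
apply: inj_card_eq => c c'; rewrite !inE /= => c_ge0 c'_ge0 /(congr1 (map_mx Posz)).
rewrite !map_Posz_absz // => /(congr1 (mulmx M)); rewrite !MK.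
by move=> /matrixP/(_ ord_max ord0); rewrite !mxE unlift_none.
Qed.

Lemma map_add_row (R S : comPzRingType) (f : {rmorphism R -> S}) (k : nat)
    (A : 'M[R]_(k, k.+1)) (b : 'I_k.+1 -> R) :
  map_mx f (add_row A b) = add_row (map_mx f A) (fun j => f (b j)).
Proof.
apply/matrixP=> i j; rewrite !mxE; case: (unlift _ _) => [i'|]; rewrite ?mxE //.
by rewrite rmorphM rmorphXn rmorphN1.
Qed.

Local Notation at_ n := (map_mx (horner_eval n%:Z)).

(** Adjugates commute with evaluation, so the adjugate over the polynomial ring yields solution
    coordinates [p i + v i * c] for all [n] at once, and each coordinate contributes one half-line
    condition on [c]. *)
Lemma eventual_qp_card_unimodular (k : nat) (A : 'M[{poly int}]_(k, k.+1))
    (m : 'cV[{poly int}]_k) (b : 'I_k.+1 -> {poly int}) :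
  \sum_j b j * \det (col' j A) = 1 ->
  (forall n, finite_set (nat_solutions (at_ n A) (at_ n m))) ->
  eventual_qp (fun n => #|` fset_set (nat_solutions (at_ n A) (at_ n m))|%fset%:Z).
Proof.
move=> b_det sol_fin; pose N := \adj (add_row A b).
pose p i := \sum_j N i (lift ord_max j) * m j ord0; pose v i := N i ord_max.
pose S n c := forall i, 0 <= (p i).[n%:Z] + (v i).[n%:Z] * c.
have card_S n : (nat_solutions (at_ n A) (at_ n m) #= (S n : set int))%card.
  have bn_det : \sum_j (b j).[n%:Z] * \det (col' j (at_ n A)) = 1.
    have := congr1 (horner_eval n%:Z) b_det; rewrite rmorph1 rmorph_sum => <-.
    by apply: eq_bigr => j _; rewrite -map_col' det_map_mx rmorphM.
  have coordE c i : (\adj (add_row (at_ n A) (fun j => (b j).[n%:Z])) *m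
      add_entry (at_ n m) c) i ord0 = (p i).[n%:Z] + (v i).[n%:Z] * c.
    rewrite -(map_add_row (horner_eval n%:Z)) -map_mx_adj mul_add_entry horner_sum mxE.
    by congr (_ + _); apply: eq_bigr => j _; rewrite !mxE hornerM.
  have -> : S n = (fun c => forall i, 0 <= (\adj (add_row (at_ n A)
      (fun j => (b j).[n%:Z])) *m add_entry (at_ n m) c) i ord0).
    by apply/funext => c; apply/propext; split=> Sc i; have := Sc i; rewrite coordE.
  exact: card_nat_solutions.
have S_fin n : finite_set (S n : set int) by rewrite -(eq_finite_set (card_S n)).
apply: (@eventual_qp_eq _ (fun n => #|` fset_set (S n : set int)|%fset%:Z)).
  by exists 0%N => n _; congr Posz; apply/fcard_eq.
apply: eventual_qp_card_interval => //; apply: eventual_qp_interval_forall => i.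
exact: eventual_qp_interval_halfline.
Qed.

Lemma at_progression (k l : nat) (A : 'M[{poly int}]_(k, l)) (T i n : nat) :
  at_ n (map_mx (comp_poly (progression T i)) A) = at_ (T * n + i)%N A.
Proof.
by apply/matrixP=> r s; rewrite !mxE /horner_eval horner_comp horner_progression.
Qed.

Lemma eventual_qp_card_coprime (k : nat) (A : 'M[{poly int}]_(k, k.+1))
    (m : 'cV[{poly int}]_k) :
  (forall n : nat, \big[gcdn/0%N]_j absz (\det (col' j A)).[n%:Z] = 1%N) ->
  (forall n, finite_set (nat_solutions (at_ n A) (at_ n m))) ->
  eventual_qp (fun n => #|` fset_set (nat_solutions (at_ n A) (at_ n m))|%fset%:Z).
Proof.
move=> /Bezout_progression[N N_gt0 bE] sol_fin.
apply: (eventual_qp_merge N_gt0) => i _; have [b b_det] := bE i.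
have comp_qp := @eventual_qp_card_unimodular k
  (map_mx (comp_poly (progression N i)) A) (map_mx (comp_poly (progression N i)) m) b.
apply: eventual_qp_eq (comp_qp _ _).
- by exists 0%N => n _; rewrite !at_progression.
- by rewrite -b_det; apply: eq_bigr => j _; rewrite -map_col' det_map_mx.
- by move=> n; rewrite !at_progression.
Qed.

(** * From integer-valued polynomials to integer coefficients *)

Lemma integer_valued_progression (I : finType) (q : I -> {poly rat}) :
  (forall i, integer_valued (q i)) ->
  exists2 T, (0 < T)%N & forall i, exists Q : I -> {poly int},
    forall s n, eval_int (T * n + i) (q s) = (Q s).[n%:Z].
Proof.
move=> q_int; have [T T_gt0 [P PE]] := common_denominator q.
have PqE s (n : nat) : (P s).[n%:Z] = T%:Z * eval_int n (q s).
  apply: (@intr_inj rat); rewrite intrM /eval_int.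
  have := q_int s n%:Z; rewrite -pmulrn => /floorK->.
  have := congr1 (horner^~ n%:R) (PE s); rewrite hornerZ => <-.
  by rewrite [n%:R]pmulrn horner_map.
exists T => // i.
have /fin_all_exists[e eE] := fun s => comp_progression (P s) T i.
(* With [P s = T q s], the class of [i] gives [P s = (P s).[i] + T e s], whose constant term is also
   a multiple of [T]; hence division by [T] stays integral. *)
exists (fun s => (eval_int i (q s))%:P + e s) => s n.
have T_neq0 : T%:Z != 0 by rewrite -lt0n.
apply: (mulfI T_neq0); rewrite -PqE hornerD hornerC mulrDr -PqE.
have := congr1 (horner^~ n%:Z) (eE s).
by rewrite horner_comp horner_progression hornerD hornerC hornerZ.
Qed.

(** The floor is not a ring morphism, so the determinant is evaluated over the rationals, where
    integer-valued entries make the evaluated matrix the image of an integer one. *)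
Lemma eval_int_det (k : nat) (A : 'M[{poly rat}]_k) (n : nat) :
  (forall i j, integer_valued (A i j)) ->
  eval_int n (\det A) = \det (map_mx (eval_int n) A).
Proof.
move=> A_int; rewrite /eval_int -[X in Num.floor X]/(horner_eval n%:R (\det A)).
rewrite -det_map_mx.
have -> : map_mx (horner_eval n%:R) A = map_mx intr (map_mx (eval_int n) A).
  apply/matrixP=> i j; rewrite !mxE /eval_int.
  by have := A_int i j n%:Z; rewrite -pmulrn => /floorK.
by rewrite det_map_mx intrKfloor.
Qed.

Lemma one_prime_eventual_qp (k : nat) (A : 'M[{poly rat}]_(k, k.+1))
    (m : 'cV[{poly rat}]_k) :
  (forall i j, integer_valued (A i j)) -> (forall i, integer_valued (m i ord0)) ->
  (forall n, finite_set (solutions A m n)) -> one_prime A ->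
  eventual_qp (fun n => (t m A n)%:Z).
Proof.
move=> intA intm fin_sol primeA.
have [T T_gt0 ABE] : exists2 T, (0 < T)%N & forall i,
    exists (B : 'M[{poly int}]_(k, k.+1)) (c : 'cV[{poly int}]_k), forall n,
      map_mx (eval_int (T * n + i)) A = at_ n B /\
      map_mx (eval_int (T * n + i)) m = at_ n c.
  (* The entries of [A] and [m] form one family, so that a single period [T] serves them all. *)
  pose q (s : 'I_k * 'I_k.+1 + 'I_k) :=
    match s with inl ij => A ij.1 ij.2 | inr i => m i ord0 end.
  have [|T T_gt0 TE] := @integer_valued_progression _ q; first by case=> [[]|] /=.
  exists T => // i; have [Q QE] := TE i.
  exists (\matrix_(r, s) Q (inl (r, s))), (\col_r Q (inr r)) => n.
  split; apply/matrixP=> r s; rewrite !mxE; first exact: QE (inl (r, s)) n.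
  by rewrite ord1; exact: QE (inr r) n.
apply: (eventual_qp_merge T_gt0) => i _; have [B [c BcE]] := ABE i.
have solE n : solutions A m (T * n + i) = nat_solutions (at_ n B) (at_ n c).
  by have [<- <-] := BcE n.
apply: eventual_qp_eq (@eventual_qp_card_coprime k B c _ _).
- by exists 0%N => n _; rewrite /t solE.
- move=> n; rewrite -[RHS](primeA (T * n + i)%N); apply: eq_bigr => j _.
  rewrite eval_int_det; last by move=> r s; rewrite mxE.
  have -> : map_mx (eval_int (T * n + i)) (col' j A) =
      col' j (map_mx (eval_int (T * n + i)) A) by exact: map_col'.
  by have [-> _] := BcE n; rewrite -map_col' det_map_mx.
- by move=> n; rewrite -solE.
Qed.

Theorem theorem1p3 (A : 'M[{poly rat}]_(2, 3)) (m : 'cV[{poly rat}]_2)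
    (intA : forall i j, integer_valued (A i j))
    (intm : forall i, integer_valued (m i ord0))
    (fin_sol : forall n : nat, finite_set (solutions A m n))
    (primeA : one_prime A) :
  exists f : nat -> int, quasi_polynomial f /\
    exists N0 : nat, forall n : nat, (N0 <= n)%N -> (t m A n)%:Z = f n.
Proof.
exact/eventual_qp_quasi_polynomial/one_prime_eventual_qp.
Qed.
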